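(* Let $K$ be a field, let $M$ be an abelian monoid with an action of $\operatorname{Inc}(\mathbb{N})$ by monoid homomorphisms, and let $\leq$ be an $\operatorname{Inc}(\mathbb{N})$-respecting monomial order on $R = KM$. Assume that $R$ satisfies the finite width condition and the finite S-pair condition, and that each truncation $R_n$ is Noetherian. Let $F\subseteq R$ be a finite set and let $I = \langle F\rangle_{\operatorname{Inc}(\mathbb{N})}$. Consider the following procedure $\operatorname{TruncatedEGB}(F)$: \begin{enumerate} \item Set $G\gets F$ and $n\gets w(F)$. \item While $G$ is not an $\operatorname{Inc}(\mathbb{N})$-equivariant Gröbner basis of $I$: replace $G$ by a finite set $G_n\subseteq \tilde I_{F,n}$ such that $\{\sigma g\mid \sigma\in \operatorname{Inc}(\mathbb{N}), g\in G_n\}\cap R_n$ is a Gröbner basis of the ideal $\tilde I_{F,n}$ of $R_n$, and then set $n\gets n+1$. \item Return $G$. \end{enumerate} If $I$ has a finite $\operatorname{Inc}(\mathbb{N})$-equivariant Gröbner basis with respect to $\leq$, then this procedure terminates (after finitely many iterations of the loop), and its output $G$ is an $\operatorname{Inc}(\mathbb{N})$-equivariant Gröbner basis of $I$.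
   Context: $\mathbb{N} = \{1,2,3,\ldots\}$. $\operatorname{Inc}(\mathbb{N})$ is the monoid (under composition) of all strictly increasing functions $\mathbb{N}\to\mathbb{N}$; write $\Pi=\operatorname{Inc}(\mathbb{N})$. $KM$ is the monoid algebra of $M$ (elements of $M$ are called monomials), on which $\Pi$ acts by $K$-linear extension of its action on $M$. Width: for $f\in R$, $w(f)$ is the smallest integer $n\ge 0$ such that every $\sigma\in\Pi$ fixing each element of $\{1,\ldots,n\}$ satisfies $\sigma f=f$ (and $w(f)=\infty$ if there is none); $w(F)=\max_{f\in F}w(f)$. The finite width condition says $w(f)<\infty$ for all $f\in R$. The truncation is the subring $R_n=\{f\in R\mid w(f)\le n\}$. Monomial order: a well-order (total order) $\leq$ on $M$ such that $a<b$ implies $ac<bc$ for all $c\in M$. It is $\Pi$-respecting if $a<b$ implies $\sigma a<\sigma b$ for all $\sigma\in\Pi$. For nonzero $f$, $\operatorname{in}_\leq f\in M$ is the largest monomial of $f$; for a set $S$, $\operatorname{in}_\leq S=\{\operatorname{in}_\leq f\mid 0\ne f\in S\}$; and for an ideal $J$, $\operatorname{in}_\leq J$ also denotes the ideal generated by these monomials. A Gröbner basis of an ideal $J$ of $R$ (or of $R_n$) is a subset of $J$ whose leading monomials generate $\operatorname{in}_\leq J$ in $R$ (respectively in $R_n$). $\Pi G=\{\sigma g\mid\sigma\in\Pi,\ g\in G\}$, and $\langle F\rangle_\Pi$ is the ideal of $R$ generated by $\Pi F$. A $\Pi$-equivariant Gröbner basis of a $\Pi$-invariant ideal $I$ is a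 set $G\subseteq I$ such that $\Pi G$ is a Gröbner basis of $I$, i.e. $\langle\operatorname{in}_\leq \Pi G\rangle=\operatorname{in}_\leq I$. Generator truncation: $\tilde I_{F,n}:=\langle \Pi F\cap R_n\rangle\cap R_n$, where $\langle\,\cdot\,\rangle$ denotes the ideal generated in $R$. Finite S-pair condition: let $M*\Pi$ be the monoid with underlying set $M\times\Pi$ and operation $(m,\sigma)(n,\tau)=(m\,\sigma(n),\sigma\tau)$, acting on $R$ by $(m,\sigma)f=m\cdot\sigma(f)$. For nonzero $f,g\in R$ put $\mathcal{S}_{f,g}=\{(m_1f,m_2g)\mid m_1,m_2\in M*\Pi,\ \operatorname{in}_\leq(m_1f)=\operatorname{in}_\leq(m_2g)\}$, which is closed under the diagonal action of $M*\Pi$. The condition says that for all nonzero $f,g\in R$ there is a finite subset $O\subseteq\mathcal{S}_{f,g}$ such that every element of $\mathcal{S}_{f,g}$ is of the form $(uh_1,uh_2)$ with $u\in M*\Pi$, $(h_1,h_2)\in O$. (It makes the test in the while-loop a finite computation.)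
   Formalization: The set G_n required in the loop need not exist (e.g. K[x_1,x_2,…], F={x_1+x_5, x_5}, n=5), so the claim is stated for executions in which a suitable G_n is available whenever the loop body is entered: each such execution terminates with an equivariant Gröbner basis of I. *)

(* Defs.v *)
From HB Require Import structures.
From mathcomp Require Import all_boot all_order all_algebra finmap.
From mathcomp Require Import boolp classical_sets wochoice.
From mathcomp Require Import monalg.

Set Implicit Arguments.
Unset Strict Implicit.
Unset Printing Implicit Defensive.

Import GRing.Theory.
Local Open Scope classical_set_scope.
Local Open Scope ring_scope.

(* Inc(N).  The natural number i of [nat] stands for i + 1 in N = {1,2,...};
   thus "σ fixes each element of {1,...,n}" reads "σ fixes every i < n". *)
Record inc := Inc {
  inc_fun :> nat -> nat;
  inc_incr : {homo inc_fun : i j / (i < j)%N}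
}.

Definition inc_id : inc := Inc (fun i j (lt_ij : (i < j)%N) => lt_ij).

Definition inc_comp (s t : inc) : inc :=
  @Inc (s \o t) (fun i j lt_ij => inc_incr s (inc_incr t lt_ij)).

Definition strict (T : eqType) (le : rel T) : rel T :=
  fun a b => (a != b) && le a b.

Definition monomial_order (T : eqType) (op : T -> T -> T) (le : rel T) : Prop :=
  well_order le /\
  forall a b c : T, strict le a b -> strict le (op a c) (op b c).

(* The monoid algebra {malg K[M]} of the library is a ring only when M is a
   [conomType], i.e. a commutative monoid in which xy = 1 forces x = y = 1.
   This is no restriction here: every commutative monoid that has a monomial
   order satisfies it. *)
Lemma monomial_order_conical (T : eqType) (op : T -> T -> T) (one : T)
    (le : rel T) :
    associative op -> commutative op -> left_id one op ->
    monomial_order op le ->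
  forall x y, op x y = one -> x = one /\ y = one.
Proof.
move=> opA opC op1 [wo mono].
have anti a b : le a b -> le b a -> a = b.
  move=> ab ba; have le_refl c : le c c.
    have [|z [[/eqP-> +] _]] := wo (pred1 c); first by exists c; rewrite inE.
    by apply; rewrite inE.
  have [|z [_ uz]] := wo (pred2 a b); first by exists a; rewrite !inE eqxx.
  have <- : z = a by apply: uz; split=> [|w]; rewrite !inE ?eqxx // => /orP[] /eqP->.
  by apply: uz; split=> [|w]; rewrite !inE ?eqxx ?orbT // => /orP[] /eqP->.
have total a b : le a b \/ le b a.
  have [|z [[+ zmin] _]] := wo (pred2 a b); first by exists a; rewrite !inE eqxx.
  by rewrite !inE => /orP[] /eqP zE; [left | right]; rewrite -zE; apply: zmin;
    rewrite !inE eqxx ?orbT.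
have nolt z : ~ strict le z one.
  move=> ltz1; pose A := [pred w | `[< exists n, w = iter n (op z) one >]].
  have [|w [[+ wmin] _]] := wo A.
    by exists one; apply/asboolP; exists 0%N.
  move=> /asboolP[n wE].
  have /andP[neq lezw] : strict le (op z w) w.
    by rewrite -[X in strict le _ X]op1; apply: mono.
  move/eqP: neq; apply; apply: anti => //; apply: wmin.
  by apply/asboolP; exists n.+1; rewrite wE.
have main x y : op x y = one -> x = one.
  move=> xy1; apply/eqP/negPn/negP => x1.
  have [lex|lex] := total x one; first by apply: (nolt x); apply/andP.
  apply: (nolt y); rewrite -(op1 y) -{2}xy1.
  by apply: mono; rewrite /strict eq_sym x1.
by move=> x y xy1; split; [apply: main xy1 | apply: (main _ x); rewrite opC].
Qed.

Section MonoidAlgebra.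
Context (K : fieldType) (M : conomType).
Local Notation R := {malg K[M]}.

Implicit Types (act : inc -> M -> M) (le : rel M) (f g : R) (n : nat).
Implicit Types (S J : set R).

Definition inc_action act : Prop :=
  [/\ forall m, act inc_id m = m,
      forall s t m, act (inc_comp s t) m = act s (act t m),
      forall s, act s mone = mone
    & forall s m1 m2, act s (mmul m1 m2) = mmul (act s m1) (act s m2)].

Definition malg_act act (s : inc) f : R :=
  \sum_(m <- msupp f) << f@_m *g act s m >>.

Definition orbit act S : set R :=
  [set h | exists s : inc, exists2 g, S g & h = malg_act act s g].

Definition ideal_of (A J : set R) : Prop :=
  [/\ J `<=` A, J 0, forall x y, J x -> J y -> J (x + y)
    & forall a x, A a -> J x -> J (a * x)].

(* For A a subring of R and S a subset of A: the ideal of A generated by S. *)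
Definition ideal_gen (A S : set R) : set R :=
  [set x | forall J, ideal_of A J -> S `<=` J -> J x].

Definition noetherian (A : set R) : Prop :=
  forall J, ideal_of A J -> exists X : {fset R},
    [set` X] `<=` A /\ J = ideal_gen A [set` X].

Definition inc_ideal act S : set R := ideal_gen setT (orbit act S).

Definition width_le act f n : Prop :=
  forall s : inc, (forall i, (i < n)%N -> s i = i) -> malg_act act s f = f.

(* [None] stands for infinite width. *)
Definition width act f : option nat :=
  if pselect (exists n, `[< width_le act f n >]) is left fin_f
  then Some (ex_minn fin_f) else None.

Definition omax (a b : option nat) : option nat :=
  if a is Some i then if b is Some j then Some (maxn i j) else None else None.

(* The maximum over the empty set is 0. *)
Definition set_width act (F : {fset R}) : option nat :=
  \big[omax/Some 0%N]_(f <- F) width act f.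

Definition finite_width act : Prop := forall f, width act f <> None.

Definition truncation act n : set R :=
  [set f | exists2 k, width act f = Some k & (k <= n)%N].

Definition inc_respecting act le : Prop :=
  forall (s : inc) a b, strict le a b -> strict le (act s a) (act s b).

(* Only meaningful for f != 0. *)
Definition in_mon le f : M :=
  xget mone [set m | m \in msupp f /\ forall m', m' \in msupp f -> le m' m].

Definition in_mons le S : set R :=
  [set << in_mon le f >> | f in [set f | S f /\ f != 0]].

Definition groebner_basis le (A J B : set R) : Prop :=
  B `<=` J /\ ideal_gen A (in_mons le B) = ideal_gen A (in_mons le J).

Definition equivariant_gb act le (I G : set R) : Prop :=
  G `<=` I /\ groebner_basis le setT I (orbit act G).

(* The action on R of the element (m, s) of the monoid M * Inc(N). *)
Definition mon_inc_act act (u : M * inc) f : R :=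
  << u.1 >> * malg_act act u.2 f.

Definition Spairs act le f g : set (R * R) :=
  [set h | exists u1 u2 : M * inc,
    in_mon le (mon_inc_act act u1 f) = in_mon le (mon_inc_act act u2 g) /\
    h = (mon_inc_act act u1 f, mon_inc_act act u2 g)].

Definition finite_Spair act le : Prop :=
  forall f g, f != 0 -> g != 0 ->
  exists2 O : {fset R * R}, [set` O] `<=` Spairs act le f g &
    forall p, Spairs act le f g p ->
    exists u : M * inc, exists2 h, h \in O &
      p = (mon_inc_act act u h.1, mon_inc_act act u h.2).

Definition trunc_ideal act (F : {fset R}) n : set R :=
  ideal_gen setT (orbit act [set` F] `&` truncation act n)
  `&` truncation act n.

Section TruncatedEGB.
Context (act : inc -> M -> M) (le : rel M) (F : {fset R}).

(* The values of the variables G and n. *)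
Definition state := ({fset R} * nat)%type.

Definition loop_guard (s : state) : Prop :=
  ~ equivariant_gb act le (inc_ideal act [set` F]) [set` s.1].

Definition loop_body (s s' : state) : Prop :=
  [/\ [set` s'.1] `<=` trunc_ideal act F s.2,
      groebner_basis le (truncation act s.2) (trunc_ideal act F s.2)
        (orbit act [set` s'.1] `&` truncation act s.2)
    & s'.2 = s.2.+1].

(* The procedure is nondeterministic: any admissible G_n may be chosen.  A run
   started with n = n0 is the sequence of states at the successive tests of the
   guard; its entries after the first failure of the guard are irrelevant.  For
   some F and n no admissible G_n exists, and then no run passes through a state
   (G, n) that satisfies the guard. *)
Definition run (n0 : nat) (s : nat -> state) : Prop :=
  s 0%N = (F, n0) /\
  forall k, loop_guard (s k) -> loop_body (s k) (s k.+1).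

(* The loop exits after exactly k iterations, with output G. *)
Definition returns (s : nat -> state) (k : nat) (G : {fset R}) : Prop :=
  [/\ forall j, (j < k)%N -> loop_guard (s j), ~ loop_guard (s k)
    & (s k).1 = G].

End TruncatedEGB.
End MonoidAlgebra.

(* Main.v *)
Require Import Defs.
From mathcomp Require Import all_boot all_order all_algebra finmap.
From mathcomp Require Import boolp classical_sets wochoice.
From mathcomp Require Import monalg.

(** Let H be a finite equivariant Groebner basis of I.  An element of I is a
    combination of finitely many elements of the orbit of F, and all elements
    involved have finite width; hence the truncated ideals
    trunc_ideal act F n increase to I and the finite set H lies in all of them
    from some n on ([inc_ideal_exhaust_fset]).

    Consider an iteration that starts with such an n and replaces G by G_n.
    For h in H, the monomial in(h) lies in the ideal of the truncated ring
    generated by the leading monomials of the orbit of G_n, hence in the ideal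
    J that the leading monomials of this orbit generate in the whole ring.
    Since the order is respected by Inc(N), taking leading monomials commutes
    with the action ([in_mon_act]), so J is stable under Inc(N) and contains
    the leading monomials of the whole orbit of H, which generate the initial
    ideal of I.  Thus G_n is an equivariant Groebner basis ([truncated_gb_equivariant]).  As n grows by
    one at each iteration, the guard must eventually fail, and its failure says
    that the output is correct. *)

Set Implicit Arguments.
Unset Strict Implicit.
Unset Printing Implicit Defensive.

Import GRing.Theory.
Local Open Scope classical_set_scope.
Local Open Scope ring_scope.

(* [orbit] alone would denote the orbits of [fingraph]. *)
Local Notation orbit := Defs.orbit.

(** * Maxima for a well-order *)

Lemma well_order_total (T : eqType) (le : rel T) : well_order le -> total le.
Proof.
have wo_T : well_order le -> wo_chain le predT by move=> wo A _; apply: wo.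
by move=> /wo_T/wo_chainW tot x y; apply: tot.
Qed.

Lemma well_order_anti (T : eqType) (le : rel T) :
  well_order le -> antisymmetric le.
Proof.
have wo_T : well_order le -> wo_chain le predT by move=> wo A _; apply: wo.
by move=> /wo_T/wo_chain_antisymmetric anti x y; apply: anti.
Qed.

(** A three-element set has a least element, and each of the three cases for
    it gives [le a c]. *)
Lemma well_order_trans (T : eqType) (le : rel T) :
  well_order le -> transitive le.
Proof.
move=> wo b a c ab bc; have anti := well_order_anti wo.
have [|z [[+ zmin] _]] := wo (pred3 a b c); first by exists a; rewrite !inE eqxx.
rewrite !inE => /or3P[] /eqP zE; subst z.
- by apply: zmin; rewrite !inE eqxx !orbT.
- have -> // : a = b by apply: anti; rewrite ab zmin // !inE eqxx.
- have <- // : b = c by apply: anti; rewrite bc zmin // !inE eqxx !orbT.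
Qed.

Lemma seq_max (T : eqType) (le : rel T) (s : seq T) :
    well_order le -> s != [::] ->
  exists2 x, x \in s & forall y, y \in s -> le y x.
Proof.
move=> wo; have tot := well_order_total wo.
have refl x : le x x by have := tot x x; rewrite orbb.
elim: s => // a [|b s] IHs _.
  by exists a => [|y]; rewrite !inE // => /eqP->.
have [//|x xs xmax] := IHs.
have [ax|xa] := orP (tot a x).
  exists x => [|y]; first by rewrite inE xs orbT.
  by rewrite inE => /predU1P[->|/xmax].
exists a => [|y]; first by rewrite inE eqxx.
rewrite inE => /predU1P[->//|/xmax yx].
exact: (well_order_trans wo) yx xa.
Qed.

(** * Generated ideals *)

Section Ideals.
Context (K : fieldType) (M : conomType).
Local Notation R := {malg K[M]}.
Implicit Types (S J A : set R).

Lemma ideal_gen_ideal S : ideal_of setT (ideal_gen setT S).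
Proof.
split=> [//|J []//|x y Ix Iy J iJ SJ|a x _ Ix J iJ SJ].
  by case: (iJ) => _ _ addJ _; apply: addJ; [apply: Ix | apply: Iy].
by case: (iJ) => _ _ _ mulJ; apply: mulJ => //; apply: Ix.
Qed.

Lemma sub_ideal_gen A S : S `<=` ideal_gen A S.
Proof. by move=> x Sx J _; apply. Qed.

Lemma ideal_gen_min A S J :
  ideal_of A J -> S `<=` J -> ideal_gen A S `<=` J.
Proof. by move=> iJ SJ x; apply. Qed.

Lemma ideal_gen_mono A S S' :
  S `<=` S' -> ideal_gen A S `<=` ideal_gen A S'.
Proof. by move=> SS' x Ix J iJ S'J; apply: Ix => // y /SS'/S'J. Qed.

End Ideals.

(** * The action of Inc(N) on the monoid algebra *)

Section Action.
Context (K : fieldType) (M : conomType) (act : inc -> M -> M).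
Hypothesis act_hom : inc_action act.
Local Notation R := {malg K[M]}.
Implicit Types (f g : R) (s t : inc) (S J : set R) (n : nat).

(** This makes the additivity of [mmap] available for the action. *)
Lemma malg_actE s f :
  malg_act act s f = mmap (@malgC M K) (fun m => << act s m >>) f.
Proof.
apply: eq_bigr => m _; rewrite mul_malgC.
by apply/malgP => k; rewrite mcoeffZ !mcoeffU mulrnAr mulr1.
Qed.

Lemma malg_actU s c m :
  malg_act act s << c *g m >> = << c *g act s m >> :> R.
Proof.
rewrite malg_actE mmapU mul_malgC.
by apply/malgP => k; rewrite mcoeffZ !mcoeffU mulrnAr mulr1.
Qed.

Lemma malg_actD s f g :
  malg_act act s (f + g) = malg_act act s f + malg_act act s g.
Proof. by rewrite !malg_actE raddfD. Qed.

Lemma malg_act0 s : malg_act act s 0 = 0 :> R.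
Proof. by rewrite malg_actE raddf0. Qed.

Lemma mulUU (c d : K) (m m' : M) :
  << c *g m >> * << d *g m' >> = << c * d *g mmul m m' >> :> R.
Proof. by rewrite malgM_def fgmulUU. Qed.

Lemma malg_act_sum s (I : Type) (r : seq I) (E : I -> R) :
  malg_act act s (\sum_(i <- r) E i) = \sum_(i <- r) malg_act act s (E i).
Proof. exact: (big_morph _ (malg_actD s) (malg_act0 s)). Qed.

Lemma malg_actM s f g :
  malg_act act s (f * g) = malg_act act s f * malg_act act s g.
Proof.
case: act_hom => _ _ _ actM.
rewrite malgME malg_act_sum mulr_suml; apply: eq_bigr => i _.
rewrite malg_act_sum mulr_sumr; apply: eq_bigr => j _.
by rewrite malg_actU actM mulUU.
Qed.

Lemma malg_act_comp s t f :
  malg_act act (inc_comp s t) f = malg_act act s (malg_act act t f).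
Proof.
case: act_hom => _ actC _ _; rewrite [in RHS]/malg_act [RHS]malg_act_sum.
by apply: eq_bigr => m _; rewrite malg_actU actC.
Qed.

Lemma orbit_act S s g : orbit act S g -> orbit act S (malg_act act s g).
Proof.
by move=> [t [h Sh ->]]; exists (inc_comp s t), h; rewrite ?malg_act_comp.
Qed.

Lemma ideal_preim s J :
  ideal_of setT J -> ideal_of setT [set x | J (malg_act act s x)].
Proof.
move=> [_ J0 addJ mulJ]; split=> //= [|x y|a x _].
- by rewrite malg_act0.
- by rewrite malg_actD; apply: addJ.
- by rewrite malg_actM; apply: mulJ.
Qed.

(** The preimage of the generated ideal under the ring endomorphism
    [malg_act act s] is an ideal that contains the generators. *)
Lemma ideal_gen_act S :
    (forall s x, S x -> S (malg_act act s x)) ->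
  forall s x, ideal_gen setT S x -> ideal_gen setT S (malg_act act s x).
Proof.
move=> stab s x; apply: (ideal_gen_min (ideal_preim s (ideal_gen_ideal S))).
by move=> y Sy /=; apply: sub_ideal_gen; apply: stab.
Qed.

(** * Truncations *)

Lemma truncationP n f : truncation act n f <-> width_le act f n.
Proof.
rewrite /truncation /= /width; split=> [[k]|fn].
  case: pselect => // ex [<-]; case: ex_minnP => m /asboolP wm _ lemn s fixs.
  by apply: wm => i ltim; apply: fixs; apply: leq_trans lemn.
case: pselect => [ex|[]]; last by exists n; apply/asboolP.
by exists (ex_minn ex) => //; case: ex_minnP => m _; apply; apply/asboolP.
Qed.

Lemma truncation_mono n n' :
  (n <= n')%N -> @truncation K M act n `<=` truncation act n'.
Proof.
by move=> le_nn' f [k wk lekn]; exists k => //; apply: leq_trans le_nn'.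
Qed.

(** The truncation is closed under sums and products because each [malg_act act s]
    is a ring endomorphism. *)
Lemma ideal_trunc n J :
  ideal_of setT J -> ideal_of (truncation act n) (J `&` truncation act n).
Proof.
move=> [_ J0 addJ mulJ]; split=> [x []//||x y|a x].
- by split=> //; apply/truncationP => s _; rewrite malg_act0.
- move=> [Jx /truncationP wx] [Jy /truncationP wy]; split; first exact: addJ.
  by apply/truncationP => s fixs; rewrite malg_actD wx ?wy.
- move=> /[dup] wA /truncationP wa [Jx /truncationP wx].
  split; first exact: mulJ.
  by apply/truncationP => s fixs; rewrite malg_actM wa ?wx.
Qed.

Lemma trunc_idealS (F : {fset R}) n :
  trunc_ideal act F n `<=` inc_ideal act [set` F].
Proof. by move=> x [+ _]; apply: ideal_gen_mono => y []. Qed.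

Lemma inc_ideal_act S s f :
  inc_ideal act S f -> inc_ideal act S (malg_act act s f).
Proof. by apply: ideal_gen_act => t x; apply: orbit_act. Qed.

Section FiniteWidth.
Hypothesis fin_width : finite_width K act.

Lemma ex_truncation f : exists n, truncation act n f.
Proof.
case fw: (width act f) => [k|]; first by exists k, k.
by case: (fin_width fw).
Qed.

Lemma set_width_fin (F : {fset R}) : exists n, set_width act F = Some n.
Proof.
apply: (big_ind (fun w => exists n, w = Some n)) => [|_ _ [i ->] [j ->]|f _].
- by exists 0%N.
- by exists (maxn i j).
- by case fw: (width act f) => [k|]; [exists k | case: (fin_width fw)].
Qed.

(** The union over [n] of the ideals generated by the elements of width at most
    [n] in the orbit of [F] is an ideal, since they form an increasing chain,
    and it contains the whole orbit. *)
Lemma inc_ideal_exhaust (F : {fset R}) f :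
    inc_ideal act [set` F] f ->
  exists n, forall n', (n <= n')%N -> trunc_ideal act F n' f.
Proof.
pose I n := ideal_gen setT (orbit act [set` F] `&` @truncation K M act n).
have idealI n : ideal_of setT (I n) by apply: ideal_gen_ideal.
have Imono n n' : (n <= n')%N -> I n `<=` I n'.
  move=> le_nn'; apply: ideal_gen_mono => x [Fx wx]; split=> //.
  exact: truncation_mono wx.
move=> If; have [|x Fx|n In] := If [set x | exists n, I n x].
- split=> //= [|x y [i Ix] [j Iy]|a x _ [i Ix]].
  + by exists 0%N; case: (idealI 0%N).
  + exists (maxn i j); case: (idealI (maxn i j)) => _ _ addI _.
    by apply: addI; [apply: Imono Ix | apply: Imono Iy];
      rewrite ?leq_maxl ?leq_maxr.
  + by exists i; case: (idealI i) => _ _ _ mulI; apply: mulI.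
- by have [n wx] := ex_truncation x; exists n; apply: sub_ideal_gen.
have [m wf] := ex_truncation f; exists (maxn n m) => n'.
rewrite geq_max => /andP[le_nn' le_mn']; split.
  exact: Imono In.
exact: truncation_mono wf.
Qed.

Lemma inc_ideal_exhaust_fset (F H : {fset R}) :
    [set` H] `<=` inc_ideal act [set` F] ->
  exists n, forall n', (n <= n')%N -> [set` H] `<=` trunc_ideal act F n'.
Proof.
move=> HI.
have /boolp.choice[nu nuP] h : exists n, h \in H ->
    forall n', (n <= n')%N -> trunc_ideal act F n' h.
  have [hH|_] := boolP (h \in H); last by exists 0%N.
  by have [n nP] := inc_ideal_exhaust (HI h hH); exists n.
exists (\max_(h <- H) nu h)%N => n' le_n' h hH; apply: nuP => //.
exact: leq_trans (leq_bigmax_seq _ hH isT) le_n'.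
Qed.

End FiniteWidth.

(** * Leading monomials *)

Section LeadingMonomials.
Context (le : rel M).
Hypotheses (le_wo : well_order le) (le_resp : inc_respecting act le).

(** The order is total and strict inequalities are preserved. *)
Lemma act_inj s : injective (act s).
Proof.
move=> a b eq_ab; apply/eqP/negPn/negP => neq_ab.
have [leab|leba] := orP (well_order_total le_wo a b).
  have /(le_resp s)/andP[] : strict le a b by apply/andP.
  by rewrite eq_ab eqxx.
have /(le_resp s)/andP[] : strict le b a by rewrite /strict eq_sym neq_ab.
by rewrite eq_ab eqxx.
Qed.

Lemma act_le s a b : le a b -> le (act s a) (act s b).
Proof.
move=> leab; have [->|neq] := eqVneq a b.
  by have := well_order_total le_wo (act s b) (act s b); rewrite orbb.
by have /(le_resp s)/andP[] : strict le a b by apply/andP.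
Qed.

Lemma in_mon_max f : f != 0 ->
  in_mon le f \in msupp f /\ forall m, m \in msupp f -> le m (in_mon le f).
Proof.
move=> f0; apply: (@xgetPex _ _ [set m | m \in msupp f /\
  forall m', m' \in msupp f -> le m' m]).
have [|m mf mmax] := @seq_max _ le (msupp f) le_wo; last by exists m.
by apply: contra f0 => /eqP s0; rewrite -msupp_eq0; apply/eqP/fsetP => m;
  rewrite inE -[LHS]/(m \in enum_fset _) s0.
Qed.

Lemma in_monE f m :
  m \in msupp f -> (forall m', m' \in msupp f -> le m' m) -> in_mon le f = m.
Proof.
move=> mf mmax; have f0 : f != 0.
  by apply: contraTneq mf => ->; rewrite msupp0 inE.
have [nf nmax] := in_mon_max f0.
by apply: (well_order_anti le_wo); rewrite mmax ?nmax.
Qed.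

Lemma mcoeff_act s f k :
  (malg_act act s f)@_k = \sum_(m <- msupp f) f@_m *+ (act s m == k).
Proof. by rewrite raddf_sum; apply: eq_bigr => m _; rewrite /= mcoeffU. Qed.

(** No cancellation occurs, because distinct monomials have distinct images. *)
Lemma msupp_act s f k :
  (k \in msupp (malg_act act s f)) <-> exists2 m, m \in msupp f & act s m = k.
Proof.
split=> [|[m mf <-]]; rewrite -mcoeff_neq0 mcoeff_act.
  apply: contraPP => nex; apply/negP/negPn/eqP; rewrite big_seq big1 // => m mf.
  by case: eqP => // eqk; case: nex; exists m.
rewrite (big_fsetD1 m) //= eqxx big_seq big1 => [|m'].
  by rewrite addr0 mcoeff_neq0.
by rewrite !inE => /andP[neq _]; rewrite (inj_eq (@act_inj s)) (negPf neq).
Qed.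

Lemma in_mon_act s f : f != 0 ->
  in_mon le (malg_act act s f) = act s (in_mon le f).
Proof.
move=> /in_mon_max[mf mmax]; apply: in_monE.
  by apply/msupp_act; exists (in_mon le f).
by move=> _ /msupp_act[m mf' <-]; apply: act_le; apply: mmax.
Qed.

Lemma malg_act_neq0 s f : f != 0 -> malg_act act s f != 0.
Proof.
move=> /in_mon_max[mf _]; rewrite -msupp_eq0.
have : act s (in_mon le f) \in msupp (malg_act act s f).
  by apply/msupp_act; exists (in_mon le f).
by apply: contraTneq => ->; rewrite inE.
Qed.

(** If [s] fixes [f], it fixes the leading monomial of [f], so the width of the
    latter is at most that of [f]. *)
Lemma truncation_in_mon n f :
  f != 0 -> truncation act n f -> truncation act n (<< in_mon le f >> : R).
Proof.
move=> f0 /truncationP wf; apply/truncationP => s fixs.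
by rewrite malg_actU -in_mon_act // wf.
Qed.

Lemma in_mons_orbit_act S s x :
    in_mons le (orbit act S) x -> in_mons le (orbit act S) (malg_act act s x).
Proof.
move=> [g [Sg g0] <-]; exists (malg_act act s g).
  by split; [apply: orbit_act | apply: malg_act_neq0].
by rewrite malg_actU in_mon_act.
Qed.

Lemma in_mons_mono S S' : S `<=` S' -> in_mons le S `<=` in_mons le S'.
Proof.
by move=> SS' _ [f [Sf f0] <-]; exists f => //; split=> //; apply: SS'.
Qed.

(** The ideal generated by [S] in the whole ring meets the truncation in one of
    the ideals over which [ideal_gen] intersects; that [S] lies in the truncation
    is essential, for otherwise no ideal of the truncation contains [S] and
    [ideal_gen (truncation act n) S] is the whole ring. *)
Lemma ideal_gen_trunc n S :
    S `<=` truncation act n ->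
  ideal_gen (truncation act n) S `<=` ideal_gen setT S.
Proof.
move=> Sn x Ix.
suff [//] : (ideal_gen setT S `&` truncation act n) x.
apply: Ix; first exact/ideal_trunc/ideal_gen_ideal.
by move=> y Sy; split; [apply: sub_ideal_gen | apply: Sn].
Qed.

(** The generators in(s h) of the initial ideal of [I], for [h] in [H], equal
    s in(h).  Hence it suffices that in(h) lies in the ideal generated by the
    leading monomials of the orbit of [G], which is stable under the action; the
    truncated Groebner basis provides this membership. *)
Lemma truncated_gb_equivariant (F G H : {fset R}) n :
    equivariant_gb act le (inc_ideal act [set` F]) [set` H] ->
    [set` H] `<=` trunc_ideal act F n ->
    [set` G] `<=` trunc_ideal act F n ->
    groebner_basis le (truncation act n) (trunc_ideal act F n)
      (orbit act [set` G] `&` truncation act n) ->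
  equivariant_gb act le (inc_ideal act [set` F]) [set` G].
Proof.
move=> [_ [_ gbH]] Hn Gn [_ gbG].
have GI : [set` G] `<=` inc_ideal act [set` F].
  exact: subset_trans Gn (@trunc_idealS F n).
have oGI : orbit act [set` G] `<=` inc_ideal act [set` F].
  by move=> _ [s [g /GI Ig ->]]; apply: inc_ideal_act.
split=> //; split=> //; apply/seteqP; split.
  by apply: ideal_gen_mono; apply: in_mons_mono.
rewrite -gbH; apply: ideal_gen_min; first exact: ideal_gen_ideal.
move=> _ [_ [[s [h hH ->]] sh0] <-].
have h0 : h != 0 by apply: contraNneq sh0 => ->; rewrite malg_act0.
rewrite in_mon_act // -malg_actU; apply: ideal_gen_act.
  by move=> t x; apply: in_mons_orbit_act.
have : ideal_gen (truncation act n) (in_mons le (trunc_ideal act F n))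
    << in_mon le h >>.
  by apply: sub_ideal_gen; exists h => //; split=> //; apply: Hn.
rewrite -gbG => /ideal_gen_trunc in_h.
apply: (ideal_gen_mono (in_mons_mono _) (in_h _)); first by move=> ? [].
by move=> _ [g [[_ wg] g0] <-]; apply: truncation_in_mon.
Qed.

End LeadingMonomials.
End Action.

(** * Termination and correctness *)

Theorem mainTheorem4 (K : fieldType) (M : conomType)
    (act : inc -> M -> M) (le : rel M)
    (act_hom : inc_action act)
    (le_mon : monomial_order (@mmul M) le)
    (le_resp : inc_respecting act le)
    (fin_width : finite_width K act)
    (fin_Spair : finite_Spair K act le)
    (noeth : forall n : nat, noetherian (@truncation K M act n))
    (F : {fset {malg K[M]}})
    (fin_gb : exists H : {fset {malg K[M]}},
       equivariant_gb act le (inc_ideal act [set` F]) [set` H]) :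
  exists2 n0 : nat, set_width act F = Some n0 &
    forall s : nat -> state K M, run act le F n0 s ->
    exists (k : nat) (G : {fset {malg K[M]}}),
      returns act le F s k G /\
      equivariant_gb act le (inc_ideal act [set` F]) [set` G].
Proof.
have [n0 wF] := set_width_fin fin_width F; exists n0 => // s [s0 step].
have [le_wo _] := le_mon; have [H gbH] := fin_gb.
have [N HN] := inc_ideal_exhaust_fset fin_width gbH.1.
have ex_exit : exists k, `[< ~ loop_guard act le F (s k) >].
  apply: contrapT => nexit.
  have guard k : loop_guard act le F (s k).
    by apply: contrapT => ng; apply: nexit; exists k; apply/asboolP.
  have sn k : (s k).2 = (n0 + k)%N.
    elim: k => [|k IHk]; first by rewrite s0 addn0.
    by have [_ _ ->] := step k (guard k); rewrite IHk addnS.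
  have [GI gbG _] := step N (guard N).
  (* At the N-th test the counter is n0 + N >= N, so H lies in the ideal whose
     Groebner basis is computed in the next iteration. *)
  apply: (guard N.+1).
  apply: (truncated_gb_equivariant act_hom le_wo le_resp gbH _ GI gbG).
  by apply: HN; rewrite sn leq_addl.
case: (ex_minnP ex_exit) => k /asboolP exit_k kmin.
exists k, (s k).1; split; last exact: contrapT exit_k.
split=> // j ltjk; apply: contrapT => ng.
by move: (kmin j); rewrite leqNgt ltjk => /(_ (asboolT ng)).
Qed.
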